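(* Let $(M,g)$ be the Hayward black hole spacetime with parameters $m>0$, $b>0$: coordinates $(t,r,\theta,\phi)$ and $g=-\frac{B}{B_1}dt^2+\frac{B_1}{B}dr^2+r^2(d\theta^2+\sin^2\theta\, d\phi^2)$, where $B=2b^2m-2mr^2+r^3$, $B_1=2b^2m+r^3$, on the domain $r>0$, $0<\theta<\pi$, $B\neq 0$. Put $B_2=4b^2m-r^3$. At every point of $M$ where $$(2b^2m+r^3)^2(4b^4m^2+4b^2mr^3-3mr^5+r^6)=36b^2m^2r^4(2b^2m-2mr^2+r^3),$$ the almost $\eta$-Ricci soliton equation holds for the soliton vector field $\xi=\frac{\partial}{\partial r}$ and the $1$-form $\eta=dr$ (components $(0,1,0,0)$): $$\frac12\pounds_\xi g+S+\sigma_2g-\sigma_3\,\eta\otimes\eta=0,$$ where $\sigma_2=\frac{4b^4m^2-2b^2mr^3+3mr^5-2r^6}{3r^4B}$ and $\sigma_3=\frac{2mrB_2}{B^2}$.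
   Context: $\pounds_\xi$ denotes the Lie derivative. An almost $\eta$-Ricci soliton is given by a vector field $\xi$, a non-zero $1$-form $\eta$ and smooth functions $\mu,\lambda$ with $\frac12\pounds_\xi g+S-\mu g+\lambda\,\eta\otimes\eta=0$. Sign of curvature: $R_{pq\mu\nu}=g_{p\alpha}(\partial_\mu\Gamma^\alpha_{q\nu}-\partial_\nu\Gamma^\alpha_{q\mu}+\Gamma^\beta_{q\nu}\Gamma^\alpha_{\beta\mu}-\Gamma^\beta_{q\mu}\Gamma^\alpha_{\beta\nu})$; Ricci tensor $S_{q\mu}=g^{p\nu}R_{pq\mu\nu}$. With this convention, for the present metric, $S_{33}=-\frac{12b^2m^2r^2}{B_1^2}$ (so $S$ is the negative of the Ricci tensor in the convention where round spheres have positive Ricci curvature). *)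

(* Defs.v *)
From HB Require Import structures.
From mathcomp Require Import all_boot all_order all_algebra.
From mathcomp Require Import all_classical all_reals all_analysis.

Set Implicit Arguments.
Unset Strict Implicit.
Unset Printing Implicit Defensive.

Import Order.TTheory GRing.Theory Num.Theory.
Import numFieldNormedType.Exports.

Local Open Scope classical_set_scope.
Local Open Scope ring_scope.

(* Tensor calculus in a single chart: points of the chart, contravariant
   vectors and covectors are the row vectors of their components, and covariant
   2-tensors are matrices. *)
Section TensorCalculus.
Variables (R : realType) (n : nat).

Definition scalar_field := 'rV[R]_n -> R.
Definition vector_field := 'rV[R]_n -> 'rV[R]_n.
Definition one_form := 'rV[R]_n -> 'rV[R]_n.
Definition tensor2_field := 'rV[R]_n -> 'M[R]_n.

Definition partial (i : 'I_n) (f : scalar_field) : scalar_field :=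
  fun x => 'D_(delta_mx 0 i) (f : 'rV[R]_n -> R^o) x.

Definition lie_derivative (xi : vector_field) (g : tensor2_field)
    : tensor2_field := fun x =>
  \matrix_(i, j) \sum_(k < n)
    (xi x 0 k * partial k (fun y => g y i j) x
     + g x k j * partial i (fun y => xi y 0 k) x
     + g x i k * partial j (fun y => xi y 0 k) x).

Definition inverse_metric (g : tensor2_field) : tensor2_field :=
  fun x => invmx (g x).

(* Levi-Civita symbols; [christoffel g a i j] is Gamma^a_{ij}. *)
Definition christoffel (g : tensor2_field) (a i j : 'I_n) : scalar_field :=
  fun x => 2^-1 * \sum_(k < n) inverse_metric g x a k *
    (partial i (fun y => g y k j) x + partial j (fun y => g y k i) x
     - partial k (fun y => g y i j) x).

Definition riemann (g : tensor2_field) (p q u v : 'I_n) : scalar_field :=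
  fun x => \sum_(a < n) g x p a *
    (partial u (christoffel g a q v) x - partial v (christoffel g a q u) x
     + \sum_(c < n) christoffel g c q v x * christoffel g a c u x
     - \sum_(c < n) christoffel g c q u x * christoffel g a c v x).

(* The contraction pairs the first and last indices of [riemann], so this is
   the negative of the Ricci tensor for which round spheres are positive. *)
Definition ricci (g : tensor2_field) : tensor2_field := fun x =>
  \matrix_(q, u) \sum_(p < n) \sum_(v < n)
    inverse_metric g x p v * riemann g p q u v x.

Definition tensor_product (eta omega : one_form) : tensor2_field :=
  fun x => \matrix_(i, j) (eta x 0 i * omega x 0 j).

Definition coordinate_vector_field (i : 'I_n) : vector_field :=
  fun=> delta_mx 0 i.

Definition coordinate_one_form (i : 'I_n) : one_form :=
  fun=> delta_mx 0 i.

End TensorCalculus.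

(* The coordinates (t, r, theta, phi) have indices 0, 1, 2, 3. *)
Definition r_index : 'I_4 := @Ordinal 4 1 isT.
Definition theta_index : 'I_4 := @Ordinal 4 2 isT.

Section Hayward.
Variable R : realType.
Implicit Types (b m r : R) (x : 'rV[R]_4).

Definition hayward_B b m r : R := 2 * b ^+ 2 * m - 2 * m * r ^+ 2 + r ^+ 3.

Definition hayward_B1 b m r : R := 2 * b ^+ 2 * m + r ^+ 3.

Definition hayward_B2 b m r : R := 4 * b ^+ 2 * m - r ^+ 3.

Definition hayward_domain b m : set 'rV[R]_4 :=
  [set x | [/\ 0 < x 0 r_index,
               0 < x 0 theta_index < pi
             & hayward_B b m (x 0 r_index) != 0]].

(* Outside [hayward_domain] the values are irrelevant: the domain is open and
   all the operators above are local. *)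
Definition hayward_metric b m : tensor2_field R 4 := fun x =>
  let r := x 0 r_index in
  let theta := x 0 theta_index in
  diag_mx (\row_(i < 4)
    [:: - (hayward_B b m r / hayward_B1 b m r);
        hayward_B1 b m r / hayward_B b m r;
        r ^+ 2;
        r ^+ 2 * sin theta ^+ 2]`_i).

Definition hayward_sigma2 b m r : R :=
  (4 * b ^+ 4 * m ^+ 2 - 2 * b ^+ 2 * m * r ^+ 3 + 3 * m * r ^+ 5 - 2 * r ^+ 6)
  / (3 * r ^+ 4 * hayward_B b m r).

Definition hayward_sigma3 b m r : R :=
  2 * m * r * hayward_B2 b m r / hayward_B b m r ^+ 2.

End Hayward.

(* Main.v *)
(* The metric is -f dt^2 + dr^2/f + r^2 dOmega^2 with f = B/B1. For any such f,
   S and the radial Lie derivative of g are diagonal, and the soliton equation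
   reduces to three scalar conditions:
     sigma3 = -f'/f^2                              (difference of tt and rr),
     r + (f + r f' - 1) + sigma2 r^2 = 0           (angular components),
     f'/2 + f (f''/2 + f'/r + sigma2) = 0          (tt component).
   The first is an identity. On the soliton locus sigma2 becomes
   12 b^2 m^2 / B1^2 - 1/r, which is the angular condition, and the left-hand
   side of the last one is, up to sign, the polynomial of the locus over
   r B1^4. *)
Require Import Defs.
From HB Require Import structures.
From mathcomp Require Import all_boot all_order all_algebra.
From mathcomp Require Import all_classical all_reals all_analysis.
From mathcomp Require Import ring.

Set Implicit Arguments.
Unset Strict Implicit.
Unset Printing Implicit Defensive.

Import Order.TTheory GRing.Theory Num.Theory.
Import numFieldNormedType.Exports.

Local Open Scope classical_set_scope.
Local Open Scope ring_scope.

(** * Differentiation rules for functions of one real variable *)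

Section PointwiseDerivatives.
Variable R : realType.
Implicit Types (f g : R -> R) (x a b : R).

Lemma is_derive_add f g x a b :
  is_derive x 1 f a -> is_derive x 1 g b ->
  is_derive x 1 (fun s => f s + g s) (a + b).
Proof. by move=> df dg; exact: is_deriveD. Qed.

Lemma is_derive_opp f x a :
  is_derive x 1 f a -> is_derive x 1 (fun s => - f s) (- a).
Proof. by move=> df; exact: is_deriveN. Qed.

Lemma is_derive_mul f g x a b :
  is_derive x 1 f a -> is_derive x 1 g b ->
  is_derive x 1 (fun s => f s * g s) (f x * b + g x * a).
Proof. by move=> df dg; exact: is_deriveM. Qed.

Lemma is_derive_exp f n x a :
  is_derive x 1 f a ->
  is_derive x 1 (fun s => f s ^+ n.+1) (n.+1%:R * f x ^+ n * a).
Proof.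
move=> df; elim: n => [|n IHn]; first by rewrite expr0 !mul1r.
rewrite (_ : (fun s => _) = (fun s => f s * f s ^+ n.+1)); last first.
  by apply/funext => s; rewrite exprS.
apply: is_derive_eq (is_derive_mul df IHn) _.
by rewrite [in RHS]mulrSr exprS; ring.
Qed.

Lemma is_derive_inv f x a :
  f x != 0 -> is_derive x 1 f a ->
  is_derive x 1 (fun s => (f s)^-1) (- f x ^- 2 * a).
Proof. by move=> fx0 df; exact: is_deriveV. Qed.

End PointwiseDerivatives.

(* Typeclass resolution would pick the library's instances, whose derivatives
   are phrased with [*:], which [field] does not see as a product. *)
Ltac derive_pointwise :=
  notypeclasses refine (is_derive_eq _ _);
  [ repeat first
    [ eassumption | exact: is_derive_cst | exact: is_derive_id
    | exact: is_derive_sin | exact: is_derive_cos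
    | notypeclasses refine (is_derive_opp _)
    | notypeclasses refine (is_derive_add _ _)
    | notypeclasses refine (is_derive_exp _ _)
    | notypeclasses refine (is_derive_mul _ _)
    | notypeclasses refine (is_derive_inv _ _) ]
  | cbv beta ].

(** Only the restriction of [f] to the coordinate line matters, and only near [x]. The line is
    parametrised by the value of the coordinate, so that [F] can be a closed form in that
    coordinate. *)
Lemma partial_along_line (R : realType) n (i : 'I_n) (f : scalar_field R n)
    (F : R -> R) (x : 'rV[R]_n) (d : R) :
  (\forall s \near x 0 i, f (x + (s - x 0 i) *: delta_mx 0 i) = F s) ->
  is_derive (x 0 i) 1 F d -> partial i f x = d.
Proof.
move=> fF dF.
suff -> : partial i f x =
    'D_1 (fun s : R => f (x + (s - x 0 i) *: delta_mx 0 i) : R^o) (x 0 i).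
  by rewrite (@near_eq_derive _ R R^o _ _ _ 1 fF); case: dF.
rewrite /partial /derive.
(* Both sides are limits of the same difference quotient: raising the parameter by [h] moves the
   point by [h] in direction [i]. *)
apply: (congr1 (fun q : R -> R^o => lim (q h @[h --> (0 : R)^']))).
apply/funext => h /=.
by rewrite [h *: 1]mulr1 addrK subrr scale0r addr0 [x + _]addrC.
Qed.

(** * Four-index sums, diagonal matrices and the trace of the curvature *)

Lemma big_ord4 (V : zmodType) (F : 'I_4 -> V) :
  \sum_(k < 4) F k =
  F (@Ordinal 4 0 isT) + F r_index + F theta_index + F (@Ordinal 4 3 isT).
Proof.
rewrite !big_ord_recl big_ord0 addr0 !addrA.
by congr (F _ + F _ + F _ + F _); apply/val_inj.
Qed.

(** With literal indices, lookups in sequences and matches on indices compute. *)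
Lemma ord4P (P : 'I_4 -> Prop) :
  P (@Ordinal 4 0 isT) -> P r_index -> P theta_index ->
  P (@Ordinal 4 3 isT) -> forall i, P i.
Proof.
by move=> P0 P1 P2 P3 [[|[|[|[|//]]]] i4];
  [move: P0|move: P1|move: P2|move: P3];
  rewrite (bool_irrelevance i4 isT).
Qed.

Lemma invmx_diag (K : fieldType) n (d : 'rV[K]_n) :
  (forall i, d 0 i != 0) ->
  diag_mx d \in unitmx /\ invmx (diag_mx d) = diag_mx (\row_i (d 0 i)^-1).
Proof.
move=> d0; have dV : diag_mx d *m diag_mx (\row_i (d 0 i)^-1) = 1%:M.
  rewrite mulmx_diag; apply/matrixP => i j; rewrite !mxE.
  by rewrite divff.
have [dU _] := mulmx1_unit dV; split=> //.
by rewrite -[RHS](mulKmx dU) dV mulmx1.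
Qed.

(** The metric factor that lowers an index in [riemann] cancels against the inverse metric of the
    trace, leaving a Kronecker delta. *)
Lemma ricci_trace (R : realType) n (g : tensor2_field R n) (x : 'rV[R]_n) q u :
  (g x)^T = g x -> g x \in unitmx ->
  ricci g x q u = \sum_(a < n)
    (partial u (christoffel g a q a) x - partial a (christoffel g a q u) x
     + \sum_(c < n) christoffel g c q a x * christoffel g a c u x
     - \sum_(c < n) christoffel g c q u x * christoffel g a c a x).
Proof.
move=> gT gU; rewrite mxE.
set X := fun a v => partial u (christoffel g a q v) x
  - partial v (christoffel g a q u) x
  + \sum_(c < n) christoffel g c q v x * christoffel g a c u x
  - \sum_(c < n) christoffel g c q u x * christoffel g a c v x.
transitivity (\sum_(a < n) \sum_(v < n) (g x *m invmx (g x)) a v * X a v).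
  under eq_bigr do under eq_bigr do rewrite mulr_sumr.
  under eq_bigr do rewrite exchange_big /=.
  rewrite exchange_big /=; apply: eq_bigr => a _.
  rewrite exchange_big /=; apply: eq_bigr => v _.
  rewrite mxE mulr_suml; apply: eq_bigr => p _.
  (* Symmetry of [g x] puts the indices in the order of a matrix product. *)
  by rewrite mulrA [_ * g x p a]mulrC -{1}gT mxE.
apply: eq_bigr => a _; rewrite mulmxV// (bigD1 a)//= big1 => [|v va].
  by rewrite mxE eqxx mul1r addr0.
by rewrite mxE eq_sym (negbTE va) mul0r.
Qed.

(** * Curvature of static spherically symmetric metrics *)

Definition static_metric (R : realType) (f : R -> R) : tensor2_field R 4 :=
  fun x => let r := x 0 r_index in let theta := x 0 theta_index in
  diag_mx (\row_(i < 4)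
    [:: - f r; (f r)^-1; r ^+ 2; r ^+ 2 * sin theta ^+ 2]`_i).

Section StaticMetric.
Variables (R : realType) (f f1 f2 : R -> R) (D : set R).
Hypothesis D_open : open D.
Hypothesis D_gt0 : forall r, D r -> 0 < r.
Hypothesis f_neq0 : forall r, D r -> f r != 0.
Hypothesis df : forall r, D r -> is_derive r 1 f (f1 r).
Hypothesis df1 : forall r, D r -> is_derive r 1 f1 (f2 r).
Implicit Types (x : 'rV[R]_4) (r theta : R).

Definition static_domain : set 'rV[R]_4 :=
  [set x | D (x 0 r_index) /\ 0 < x 0 theta_index < pi].

(** Agreement of [h] with [H] on the domain suffices: every coordinate line through [x] stays in the
    domain near [x]. *)
Lemma partial_static (h : scalar_field R 4) (H : R -> R -> R) i x (hr ht : R) :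
  static_domain x ->
  (forall y, static_domain y -> h y = H (y 0 r_index) (y 0 theta_index)) ->
  is_derive (x 0 r_index) 1 (H^~ (x 0 theta_index)) hr ->
  is_derive (x 0 theta_index) 1 (H (x 0 r_index)) ht ->
  partial i h x = [:: 0; hr; ht; 0]`_i.
Proof.
move=> [Dx tx] hH dHr dHt; move: i; apply: ord4P => /=.
(* Moving along t fixes r and theta, so [h] is constant on this line; phi is treated alike. *)
- apply: (@partial_along_line _ _ _ _
    (cst (H (x 0 r_index) (x 0 theta_index)))).
  by apply: filterE => s; rewrite hH /static_domain /= !mxE /= !mulr0 !addr0.
- apply: partial_along_line dHr.
  have : \forall s \near x 0 r_index, D s by exact: open_nbhs_nbhs.
  apply: filterS => s Ds.
  by rewrite hH /static_domain /= !mxE /= !mulr0 !addr0 mulr1 subrKC.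
- apply: partial_along_line dHt.
  have : \forall s \near x 0 theta_index, s \in `]0, pi[.
    by apply: near_in_itvoo; rewrite in_itv.
  apply: filterS => s; rewrite in_itv /= => st.
  by rewrite hH /static_domain /= !mxE /= !mulr0 !addr0 mulr1 subrKC.
- apply: (@partial_along_line _ _ _ _
    (cst (H (x 0 r_index) (x 0 theta_index)))).
  by apply: filterE => s; rewrite hH /static_domain /= !mxE /= !mulr0 !addr0.
Qed.

(** Closed forms of the Levi-Civita symbols, since the curvature differentiates them once more. *)
Definition static_christoffel (a i j : nat) r theta : R :=
  match a, i, j with
  | 0%N, 0%N, 1%N | 0%N, 1%N, 0%N => f1 r / (2 * f r)
  | 1%N, 0%N, 0%N => f r * f1 r / 2
  | 1%N, 1%N, 1%N => - (f1 r / (2 * f r))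
  | 1%N, 2%N, 2%N => - (r * f r)
  | 1%N, 3%N, 3%N => - (r * f r * sin theta ^+ 2)
  | 2%N, 1%N, 2%N | 2%N, 2%N, 1%N | 3%N, 1%N, 3%N | 3%N, 3%N, 1%N => r^-1
  | 2%N, 3%N, 3%N => - (sin theta * cos theta)
  | 3%N, 2%N, 3%N | 3%N, 3%N, 2%N => cos theta / sin theta
  | _, _, _ => 0
  end.

Definition static_christoffel_dr (a i j : nat) r theta : R :=
  match a, i, j with
  | 0%N, 0%N, 1%N | 0%N, 1%N, 0%N =>
      (f2 r * f r - f1 r ^+ 2) / (2 * f r ^+ 2)
  | 1%N, 0%N, 0%N => (f1 r ^+ 2 + f r * f2 r) / 2
  | 1%N, 1%N, 1%N => - ((f2 r * f r - f1 r ^+ 2) / (2 * f r ^+ 2))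
  | 1%N, 2%N, 2%N => - (f r + r * f1 r)
  | 1%N, 3%N, 3%N => - ((f r + r * f1 r) * sin theta ^+ 2)
  | 2%N, 1%N, 2%N | 2%N, 2%N, 1%N | 3%N, 1%N, 3%N | 3%N, 3%N, 1%N => - r ^- 2
  | _, _, _ => 0
  end.

Definition static_christoffel_dtheta (a i j : nat) r theta : R :=
  match a, i, j with
  | 1%N, 3%N, 3%N => - (2 * r * f r * sin theta * cos theta)
  | 2%N, 3%N, 3%N => sin theta ^+ 2 - cos theta ^+ 2
  | 3%N, 2%N, 3%N | 3%N, 3%N, 2%N => - sin theta ^- 2
  | _, _, _ => 0
  end.

Definition static_metric_dr (i j : nat) r theta : R :=
  match i, j with
  | 0%N, 0%N => - f1 r
  | 1%N, 1%N => - (f1 r / f r ^+ 2)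
  | 2%N, 2%N => 2 * r
  | 3%N, 3%N => 2 * r * sin theta ^+ 2
  | _, _ => 0
  end.

Definition static_metric_dtheta (i j : nat) r theta : R :=
  match i, j with
  | 3%N, 3%N => 2 * r ^+ 2 * sin theta * cos theta
  | _, _ => 0
  end.

Lemma partial_static_metric (k i j : 'I_4) x : static_domain x ->
  partial k (fun y => static_metric f y i j) x =
  [:: 0; static_metric_dr i j (x 0 r_index) (x 0 theta_index);
      static_metric_dtheta i j (x 0 r_index) (x 0 theta_index); 0]`_k.
Proof.
move=> Dx; have [Dr tx] := Dx.
have fx0 := f_neq0 Dr; have dfx := df Dr.
apply: (@partial_static _ (fun r theta => if i == j then
  [:: - f r; (f r)^-1; r ^+ 2; r ^+ 2 * sin theta ^+ 2]`_i else 0)) => //.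
- by move=> y _; rewrite !mxE; case: (i == j).
- move: i j; do 2 apply: ord4P; rewrite /=; try exact: is_derive_cst;
    derive_pointwise; by field.
- move: i j; do 2 apply: ord4P; rewrite /=; try exact: is_derive_cst;
    derive_pointwise; by field.
Qed.

Lemma static_metric_inverse x : static_domain x ->
  static_metric f x \in unitmx /\
  forall a k, inverse_metric (static_metric f) x a k =
   (static_metric f x a a)^-1 *+ (a == k).
Proof.
move=> [Dr tx].
have [|gU gV] := @invmx_diag R 4 (\row_(i < 4)
    [:: - f (x 0 r_index); (f (x 0 r_index))^-1; x 0 r_index ^+ 2;
        x 0 r_index ^+ 2 * sin (x 0 theta_index) ^+ 2]`_i).
  have fx0 := f_neq0 Dr; have rx0 := lt0r_neq0 (D_gt0 Dr).
  have sx0 := lt0r_neq0 (sin_gt0_pi tx).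
  by apply: ord4P; rewrite mxE /= ?oppr_eq0 ?invr_eq0 ?mulf_neq0 ?expf_neq0.
split=> // a k; rewrite /inverse_metric /static_metric gV !mxE eqxx.
by rewrite mulr1n.
Qed.

Lemma christoffel_static (a i j : 'I_4) x : static_domain x ->
  christoffel (static_metric f) a i j x =
  static_christoffel a i j (x 0 r_index) (x 0 theta_index).
Proof.
move=> Dx; have [Dr tx] := Dx; have [_ gV] := static_metric_inverse Dx.
have fx0 := f_neq0 Dr; have rx0 := lt0r_neq0 (D_gt0 Dr).
have sx0 := lt0r_neq0 (sin_gt0_pi tx).
(* The inverse metric is diagonal, so only the term [k = a] survives. *)
rewrite /christoffel (bigD1 a)//= big1 => [|k ka]; last first.
  by rewrite gV eq_sym (negbTE ka) mulr0n mul0r.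
rewrite addr0 gV eqxx mulr1n !partial_static_metric// !mxE eqxx mulr1n.
by move: a i j; do 3 apply: ord4P; rewrite /=; field; rewrite ?fx0 ?rx0 ?sx0.
Qed.

Lemma partial_static_christoffel (k a i j : 'I_4) x : static_domain x ->
  partial k (christoffel (static_metric f) a i j) x =
  [:: 0; static_christoffel_dr a i j (x 0 r_index) (x 0 theta_index);
      static_christoffel_dtheta a i j (x 0 r_index) (x 0 theta_index); 0]`_k.
Proof.
move=> Dx; have [Dr tx] := Dx.
have fx0 := f_neq0 Dr; have dfx := df Dr; have df1x := df1 Dr.
have rx0 := lt0r_neq0 (D_gt0 Dr); have sx0 := lt0r_neq0 (sin_gt0_pi tx).
(* [derive_pointwise] discharges nonzero denominators by assumption, so this one has to be in the
   context in exactly this form. *)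
have f2x0 : 2 * f (x 0 r_index) != 0 by rewrite mulf_neq0// pnatr_eq0.
apply: (@partial_static _ (static_christoffel a i j)) => //.
- by move=> y Dy; rewrite christoffel_static.
- move: a i j; do 3 apply: ord4P; rewrite /=; try exact: is_derive_cst;
    derive_pointwise; by field; rewrite ?fx0.
(* The derivative of [cos theta / sin theta] takes its stated form by the Pythagorean identity. *)
- move: a i j; do 3 apply: ord4P; rewrite /=; try exact: is_derive_cst;
    derive_pointwise; by field: (cos2sin2 (x 0 theta_index)).
Qed.

(** Here [s_t] is [(r^2 f')' / (2 r^2)] and [s_theta] is [(r f)' - 1]; both vanish for the
    Schwarzschild profile [1 - c/r]. *)
Definition static_ricci r theta : 'M[R]_4 :=
  let s_t := f2 r / 2 + f1 r / r in
  let s_theta := f r + r * f1 r - 1 in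
  diag_mx (\row_(i < 4)
    [:: - (f r * s_t); s_t / f r; s_theta; s_theta * sin theta ^+ 2]`_i).

Lemma ricci_static x : static_domain x ->
  ricci (static_metric f) x = static_ricci (x 0 r_index) (x 0 theta_index).
Proof.
move=> Dx; have [Dr tx] := Dx; have [gU _] := static_metric_inverse Dx.
have fx0 := f_neq0 Dr.
have rx0 := lt0r_neq0 (D_gt0 Dr); have sx0 := lt0r_neq0 (sin_gt0_pi tx).
apply/matrixP => q u; rewrite ricci_trace//; last exact: tr_diag_mx.
under eq_bigr do rewrite !partial_static_christoffel// !big_ord4
  !christoffel_static//.
rewrite big_ord4 !mxE.
(* This identity turns [c ^+ 2 / s ^+ 2 - s ^- 2] into the constant -1 of [s_theta]. *)
have := cos2sin2 (x 0 theta_index).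
set c := cos _ ; set s := sin _; move=> cs.
move: q u; do 2 apply: ord4P; rewrite /= -/c -/s ?mulr0n ?mulr1n;
  by field: cs; rewrite ?fx0 ?rx0 ?sx0.
Qed.

(** The vector field has constant components, so only the radial derivative of the metric is
    left. *)
Lemma lie_radial_static x : static_domain x ->
  lie_derivative (@coordinate_vector_field R 4 r_index) (static_metric f) x =
  diag_mx (\row_(i < 4) static_metric_dr i i (x 0 r_index) (x 0 theta_index)).
Proof.
move=> Dx; have [Dr tx] := Dx.
have d0 i k : partial i
    (fun y => @coordinate_vector_field R 4 r_index y 0 k) x = 0.
  exact: derive_cst.
apply/matrixP => i j; rewrite mxE.
under eq_bigr do rewrite !d0 !mulr0 !addr0 partial_static_metric// mxE /=.
rewrite big_ord4 /= !mul0r !mul1r add0r !addr0 !mxE.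
by move: i j; do 2 apply: ord4P.
Qed.

End StaticMetric.

(** * The Hayward profile and its derivatives *)

Section HaywardMetric.
Variables (R : realType) (m b : R).
Hypotheses (m_gt0 : 0 < m) (b_gt0 : 0 < b).
Implicit Type r : R.
Local Notation B := (hayward_B b m).
Local Notation B1 := (hayward_B1 b m).
Local Notation B2 := (hayward_B2 b m).

Definition hayward_radii : set R := [set r | 0 < r /\ B r != 0].

Definition hayward_f r := B r / B1 r.

Definition hayward_df r := - (2 * m * r * B2 r) / B1 r ^+ 2.

Definition hayward_d2f r :=
  - (4 * m * (4 * b ^+ 4 * m ^+ 2 - 14 * b ^+ 2 * m * r ^+ 3 + r ^+ 6))
  / B1 r ^+ 3.

(** The equality holds on the whole chart: inverting a quotient swaps its terms even if one is 0, as
    the inverse of 0 is 0. *)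
Lemma hayward_metricE : hayward_metric b m = static_metric hayward_f.
Proof. by apply/funext => x; rewrite /static_metric /hayward_f invf_div. Qed.

Lemma hayward_B1_neq0 r : 0 < r -> B1 r != 0.
Proof.
by move=> r0; rewrite lt0r_neq0// addr_gt0 ?mulr_gt0 ?exprn_gt0.
Qed.

Lemma is_derive_hayward_B r : is_derive r 1 B (- 4 * m * r + 3 * r ^+ 2).
Proof. by rewrite /hayward_B; derive_pointwise; ring. Qed.

Lemma hayward_radii_open : open hayward_radii.
Proof.
apply: openI; first exact: open_gt.
apply: (@open_comp _ _ B [set s | s != 0]); last exact: open_neq.
move=> r _; apply: differentiable_continuous; apply/derivable1_diffP.
by have [] := is_derive_hayward_B r.
Qed.

Lemma is_derive_hayward_f r : hayward_radii r ->
  is_derive r 1 hayward_f (hayward_df r).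
Proof.
move=> [/hayward_B1_neq0 B10 _]; move: B10.
rewrite /hayward_f /hayward_df /hayward_B /hayward_B1 /hayward_B2 => B10.
by derive_pointwise; field.
Qed.

Lemma is_derive_hayward_df r : hayward_radii r ->
  is_derive r 1 hayward_df (hayward_d2f r).
Proof.
move=> [/hayward_B1_neq0 B10 _]; have B12 := expf_neq0 2 B10; move: B10 B12.
rewrite /hayward_df /hayward_d2f /hayward_B1 /hayward_B2 => B10 B12.
by derive_pointwise; field.
Qed.

Lemma hayward_sigma3E r : hayward_radii r ->
  hayward_sigma3 b m r = - (hayward_df r / hayward_f r ^+ 2).
Proof.
move=> [/hayward_B1_neq0 B10 B0]; rewrite /hayward_sigma3 /hayward_df.
by rewrite /hayward_f; field; rewrite B0 B10.
Qed.

(** * The scalar conditions on the soliton locus *)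

Section SolitonLocus.
Variable r : R.
Hypothesis r_radius : hayward_radii r.
Hypothesis soliton_locus :
  B1 r ^+ 2 *
    (4 * b ^+ 4 * m ^+ 2 + 4 * b ^+ 2 * m * r ^+ 3 - 3 * m * r ^+ 5 + r ^+ 6)
  = 36 * b ^+ 2 * m ^+ 2 * r ^+ 4 * B r.

(** Identically, [sigma2 + 1/r = P / (3 r^4 B)], where [P] is the sextic factor in
    [soliton_locus]. *)
Lemma hayward_sigma2E :
  hayward_sigma2 b m r = 12 * b ^+ 2 * m ^+ 2 / B1 r ^+ 2 - r^-1.
Proof.
have [r0 B0] := r_radius; have B10 := hayward_B1_neq0 r0.
have rn0 := lt0r_neq0 r0.
(* The fraction is expanded by [B1 r ^+ 2] so that the left-hand side of [soliton_locus] appears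
   literally. *)
transitivity (B1 r ^+ 2 *
  (4 * b ^+ 4 * m ^+ 2 + 4 * b ^+ 2 * m * r ^+ 3 - 3 * m * r ^+ 5 + r ^+ 6)
  / (3 * r ^+ 4 * B r * B1 r ^+ 2) - r^-1).
  rewrite /hayward_sigma2; move: B0 B10; rewrite /hayward_B /hayward_B1.
  by move=> B0 B10; field; rewrite rn0 B0 B10.
by rewrite soliton_locus; field; rewrite rn0 B0 B10.
Qed.

(** For this profile [f + r f' - 1 = - 12 b^2 m^2 r^2 / B1^2], which cancels against
    [r + sigma2 r^2]. *)
Lemma hayward_angular_soliton :
  r + (hayward_f r + r * hayward_df r - 1) + hayward_sigma2 b m r * r ^+ 2 = 0.
Proof.
have [r0 _] := r_radius; have B10 := hayward_B1_neq0 r0.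
have rn0 := lt0r_neq0 r0; rewrite hayward_sigma2E.
move: B10; rewrite /hayward_f /hayward_df /hayward_B /hayward_B1 /hayward_B2.
by move=> B10; field; rewrite rn0 B10.
Qed.

(** The locus enters twice: it rewrites [sigma2], and then it annihilates the resulting
    numerator. *)
Lemma hayward_radial_soliton :
  hayward_df r / 2 + hayward_f r *
    (hayward_d2f r / 2 + hayward_df r / r + hayward_sigma2 b m r) = 0.
Proof.
have [r0 _] := r_radius; have B10 := hayward_B1_neq0 r0.
have rn0 := lt0r_neq0 r0; rewrite hayward_sigma2E.
transitivity ((36 * b ^+ 2 * m ^+ 2 * r ^+ 4 * B r - B1 r ^+ 2 *
  (4 * b ^+ 4 * m ^+ 2 + 4 * b ^+ 2 * m * r ^+ 3 - 3 * m * r ^+ 5 + r ^+ 6))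
  / (r * B1 r ^+ 4)).
  move: B10; rewrite /hayward_f /hayward_df /hayward_d2f.
  rewrite /hayward_B /hayward_B1 /hayward_B2.
  by move=> B10; field; rewrite rn0 B10.
by rewrite soliton_locus subrr mul0r.
Qed.

End SolitonLocus.

End HaywardMetric.

Theorem theorem6p2 (R : realType) (m b : R) (hm : 0 < m) (hb : 0 < b)
  (x : 'rV[R]_4) (hx : hayward_domain b m x) :
  let r := x 0 r_index in
  let g := hayward_metric b m in
  let xi := @coordinate_vector_field R 4 r_index in
  let eta := @coordinate_one_form R 4 r_index in
  (2 * b ^+ 2 * m + r ^+ 3) ^+ 2 *
    (4 * b ^+ 4 * m ^+ 2 + 4 * b ^+ 2 * m * r ^+ 3 - 3 * m * r ^+ 5 + r ^+ 6)
  = 36 * b ^+ 2 * m ^+ 2 * r ^+ 4 *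
    (2 * b ^+ 2 * m - 2 * m * r ^+ 2 + r ^+ 3) ->
  2^-1 *: lie_derivative xi g x + ricci g x
  + hayward_sigma2 b m r *: g x
  - hayward_sigma3 b m r *: tensor_product eta eta x = 0.
Proof.
move=> r g xi eta soliton_locus; rewrite /g hayward_metricE.
have [r0 tx B0] := hx; have Dr : hayward_radii m b r by [].
have Dx : static_domain (hayward_radii m b) x by [].
have D_gt0 s : hayward_radii m b s -> 0 < s by case.
have f_neq0 s : hayward_radii m b s -> hayward_f m b s != 0.
  by move=> [s0 Bs]; rewrite mulf_neq0 ?invr_eq0// hayward_B1_neq0.
have D_open := @hayward_radii_open _ m b.
have df := is_derive_hayward_f hm hb.
have df1 := is_derive_hayward_df hm hb.
rewrite (lie_radial_static D_open f_neq0 df Dx).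
rewrite (ricci_static D_open D_gt0 f_neq0 df df1 Dx).
rewrite (hayward_sigma3E hm hb Dr).
have radial := hayward_radial_soliton hm hb Dr soliton_locus.
have angular := hayward_angular_soliton hm hb Dr soliton_locus.
have fr0 := f_neq0 _ Dr; have rn0 : r != 0 := lt0r_neq0 r0.
apply/matrixP => i j; rewrite !mxE.
move: i j; do 2 apply: ord4P; rewrite /= -/r ?mulr0n ?mulr1n; try by ring.
(* The tt entry is the opposite of the left-hand side of [radial]. *)
- by apply: oppr_inj; rewrite oppr0; apply: etrans radial; field;
     rewrite rn0 fr0.
(* In the rr entry [sigma3] reverses the sign of the Lie derivative term, which leaves the left-hand
   side of [radial] over [f^2]. *)
- transitivity (0 / hayward_f m b r ^+ 2); last by rewrite mul0r.
  by rewrite -[X in X / _]radial; field; rewrite rn0 fr0.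
- by apply: etrans angular; field.
(* The phi entry is [sin theta ^+ 2] times the theta entry. *)
- rewrite -[RHS](mul0r (sin (x 0 theta_index) ^+ 2)) -[in RHS]angular.
  by field.
Qed.
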